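(* Let $q \geq 4$ be a prime power, let $\mathbb{F}_q$ be the finite field with $q$ elements, let $l$ be a positive integer, and let $a_1, \dots, a_l$ be $l$ distinct elements of $\mathbb{F}_q$. Set $D := \mathbb{F}_q \setminus \{a_1, \dots, a_l\} = \{x_1, \dots, x_{q-l}\}$ and let $k$ be an integer with $2 \leq k \leq q-l-1$. For $1 \leq j \leq l$, define $$u_j(x) := \lambda_j (x-a_j)^{q-2} + r_j(x),$$ where $\lambda_j \in \mathbb{F}_q^*$ and $r_j(x) \in \mathbb{F}_q[x]$ is a polynomial of degree at most $k-1$. Then each of the received words $u_1(D), \dots, u_l(D)$ is a deep hole of the generalized Reed-Solomon code $\mathcal{C}_q(D,k)$, i.e. $d(u_j(D), \mathcal{C}_q(D,k)) = q-l-k$ for every $1 \le j \le l$.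
   Context: For $f(x) \in \mathbb{F}_q[x]$ and $D = \{x_1, \dots, x_{n}\} \subseteq \mathbb{F}_q$, write $f(D) := (f(x_1), \dots, f(x_{n})) \in \mathbb{F}_q^{n}$. The generalized Reed-Solomon code with evaluation set $D$ and dimension $k$ is $\mathcal{C}_q(D,k) := \{ f(D) : f(x) \in \mathbb{F}_q[x], \deg f \leq k-1\}$. The Hamming distance $d(u,v)$ between two words of $\mathbb{F}_q^{n}$ is the number of coordinates in which they differ; the error distance of a word $u$ to the code $\mathcal{C}$ is $d(u, \mathcal{C}) := \min\{ d(u,v) : v \in \mathcal{C}\}$. The covering radius of $\mathcal{C}_q(D,k)$ is $n-k$, and a word $u \in \mathbb{F}_q^{n}$ is called a deep hole of $\mathcal{C}_q(D,k)$ if $d(u, \mathcal{C}_q(D,k)) = n-k$ (here $n = q-l$). *)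

(* Defs.v *)
From HB Require Import structures.
From mathcomp Require Import all_boot all_order all_algebra.

Set Implicit Arguments.
Unset Strict Implicit.
Unset Printing Implicit Defensive.

Import GRing.Theory.
Local Open Scope ring_scope.

(* f(D), for the evaluation set D enumerated by x. *)
Definition eval_word (F : finFieldType) (n : nat) (x : n.-tuple F)
    (f : {poly F}) : 'rV[F]_n :=
  \row_(i < n) f.[tnth x i].

(* {poly_k F} is the finite type of polynomials of size at most k, i.e. of
   degree at most k - 1. *)
Definition grs_code (F : finFieldType) (n : nat) (x : n.-tuple F) (k : nat) :
    {set 'rV[F]_n} :=
  [set eval_word x (val f) | f : {poly_k F}].

Definition hamming_dist (F : finFieldType) (n : nat) (u v : 'rV[F]_n) : nat :=
  #|[set i : 'I_n | u ord0 i != v ord0 i]|.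

(* All Hamming distances are at most n, so for nonempty C the initial value n
   does not affect the minimum. *)
Definition error_dist (F : finFieldType) (n : nat) (u : 'rV[F]_n)
    (C : {set 'rV[F]_n}) : nat :=
  \big[minn/n]_(v in C) hamming_dist u v.

Definition deep_hole (F : finFieldType) (n : nat) (x : n.-tuple F) (k : nat)
    (u : 'rV[F]_n) : Prop :=
  error_dist u (grs_code x k) = (n - k)%N.

(* Main.v *)
Require Import Defs.
From mathcomp Require Import all_boot all_order all_algebra finfield.

Import GRing.Theory.
Local Open Scope ring_scope.

(** On [D] the word of [lam (x - a)^(q-2) + r] is that of [lam / (x - a) + r].
    If it agrees with [f] of degree [< k] at [y], then [y] is a root of
    [(x - a) (f - r) - lam], which has degree at most [k] and is nonzero because
    its value at [a] is [- lam]; so there are at most [k] agreements.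
    Conversely, the remainder of any polynomial modulo the product of
    [x - x_i] over [k] evaluation points is a codeword polynomial agreeing with
    it at these [k] points. *)

Section ErrorDistance.

Variables (F : finFieldType) (n : nat).
Implicit Types (u v : 'rV[F]_n) (C : {set 'rV[F]_n}) (x : n.-tuple F).

Lemma error_dist_le u C v : v \in C -> (error_dist u C <= hamming_dist u v)%N.
Proof.
move=> vC; rewrite /error_dist -minEnat -leEnat.
exact: Order.TotalTheory.bigmin_le_cond.
Qed.

(** The condition [m <= n] handles the initial value [n] of the iterated minimum. *)
Lemma error_dist_ge u C m : (m <= n)%N ->
  (forall v, v \in C -> (m <= hamming_dist u v)%N) -> (m <= error_dist u C)%N.
Proof.
move=> le_mn le_mC; apply: (big_ind (fun d => m <= d)%N) => // d e md me.
by rewrite leq_min md.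
Qed.

(** Turns both distance bounds into counts of agreements: at least [k] for the upper bound, at most
    [k] for the lower one. *)
Lemma hamming_distE u v :
  hamming_dist u v = (n - #|[set i : 'I_n | u ord0 i == v ord0 i]|)%N.
Proof.
set A := [set i | _]; rewrite -[X in (X - _)%N]card_ord -(cardsC A) addKn.
by rewrite /hamming_dist; congr #|pred_of_set _|; apply/setP => i; rewrite !inE.
Qed.

Lemma mem_grs_code x k (f : {poly F}) :
  (size f <= k)%N -> eval_word x f \in grs_code x k.
Proof. by move=> sf; apply/imsetP; exists (NPoly sf). Qed.

Lemma grs_codeP x k v : v \in grs_code x k ->
  exists2 f : {poly F}, (size f <= k)%N & v = eval_word x f.
Proof. by case/imsetP=> f _ ->; exists (val f) => //; apply: size_npoly. Qed.

(** Distinct indices give distinct points, so the indices counted inject into the roots of [p]. *)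
Lemma card_roots_tuple x (p : {poly F}) : uniq x -> p != 0 ->
  (#|[set i : 'I_n | root p (tnth x i)]| < size p)%N.
Proof.
move=> /tuple_uniqP x_inj p0; set A := [set i | _].
rewrite cardE -(size_map (tnth x)); apply: max_poly_roots => //.
  by apply/allP => _ /mapP[i + ->]; rewrite mem_enum inE.
by rewrite map_inj_uniq ?enum_uniq.
Qed.

Lemma error_dist_grs_le x k (g : {poly F}) : (k <= n)%N ->
  (error_dist (eval_word x g) (grs_code x k) <= n - k)%N.
Proof.
move=> le_kn; pose A := [set i : 'I_n | (i < k)%N].
have cardA : #|A| = k.
  rewrite -sum1dep_card (big_ord_narrow le_kn).
  by rewrite sum1_card card_ord.
pose P := \prod_(i in A) ('X - (tnth x i)%:P).
have sP : size P = k.+1 by rewrite /P -big_enum size_prod_XsubC -cardE cardA.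
have P0 : P != 0 by rewrite -size_poly_eq0 sP.
have sf : (size (modp g P) <= k)%N by rewrite -ltnS -sP ltn_modp.
apply: leq_trans (error_dist_le _ _ _ (mem_grs_code x k _ sf)) _.
rewrite hamming_distE leq_sub2l // -{1}cardA; apply/subset_leq_card/subsetP.
(* In [g = (g %/ P) * P + g %% P] the first term vanishes at the points indexed by [A]. *)
move=> i iA; rewrite inE !mxE {1}(divp_eq g P) hornerD hornerM.
rewrite [P.[_]](_ : _ = 0) ?mulr0 ?add0r //.
by rewrite horner_prod (bigD1 i) //= hornerXsubC subrr mul0r.
Qed.

End ErrorDistance.

Lemma finField_expf_card_sub2 (F : finFieldType) (y : F) :
  y != 0 -> y ^+ (#|F| - 2) = y^-1.
Proof.
(* Multiplying both sides by [y] twice reduces the claim to [y ^+ #|F| = y]. *)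
move=> y0; apply/(mulfI y0)/(mulfI y0); rewrite divff // mulr1 mulrA -expr2.
by rewrite -exprD subnKC ?finNzRing_gt1 // expf_card.
Qed.

Lemma error_dist_grs_inv_ge (F : finFieldType) (n k : nat) (x : n.-tuple F)
    (a c : F) (r : {poly F}) :
    uniq x -> a \notin x -> c != 0 -> (size r <= k)%N ->
  (n - k <= error_dist
      (eval_word x (c *: ('X - a%:P) ^+ (#|F| - 2) + r)) (grs_code x k))%N.
Proof.
move=> x_uniq xa c0 sr; apply: error_dist_ge; first exact: leq_subr.
move=> _ /grs_codeP[f sf ->]; rewrite hamming_distE leq_sub2l //.
pose p := ('X - a%:P) * (f - r) - c%:P.
have p0 : p != 0.
  apply: contra_neq c0 => /(congr1 (horner^~ a)).
  rewrite !hornerE subrr mul0r sub0r => /eqP.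
  by rewrite oppr_eq0 => /eqP.
have sp : (size p <= k.+1)%N.
  apply: leq_trans (size_polyD _ _) _; rewrite geq_max size_polyN.
  rewrite (leq_trans (size_polyC_leq1 _)) // andbT.
  apply: leq_trans (size_polyMleq _ _) _; rewrite size_XsubC /= ltnS.
  by apply: leq_trans (size_polyD _ _) _; rewrite geq_max size_polyN sf.
(* The root count is strictly below [size p <= k.+1], which leaves at most [k] agreements. *)
rewrite -ltnS; apply: leq_trans sp.
apply: leq_ltn_trans (card_roots_tuple _ _ x p x_uniq p0).
apply/subset_leq_card/subsetP => i; rewrite !inE !mxE => /eqP.
(* Since [a] is not an evaluation point, the power of [tnth x i - a] is its inverse, and clearing
   this denominator turns the agreement into a root of [p]. *)
have ya : tnth x i - a != 0.
  by rewrite subr_eq0; apply: contraNneq xa => <-; apply: mem_tnth.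
rewrite !hornerE finField_expf_card_sub2 // => fE.
by rewrite /root !hornerE -fE addrK mulrCA divff // mulr1 subrr.
Qed.

Theorem theorem1p2 (q : nat) (hq : (4 <= q)%N)
    (F : finFieldType) (hF : #|F| = q)
    (l : nat) (hl : (0 < l)%N)
    (a : 'I_l -> F) (ha : injective a)
    (x : (q - l).-tuple F) (hx : uniq x)
    (hD : [set y in x] = ~: [set a j | j : 'I_l])
    (k : nat) (hk : (2 <= k <= q - l - 1)%N)
    (lam : 'I_l -> F) (hlam : forall j, lam j != 0)
    (r : 'I_l -> {poly F}) (hr : forall j, (size (r j) <= k)%N) :
  forall j : 'I_l,
    deep_hole x k
      (eval_word x (lam j *: ('X - (a j)%:P) ^+ (q - 2) + r j)).
Proof.
move=> j; have /andP[_ le_k] := hk.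
have xa : a j \notin x.
  (* [a j] lies in the image whose complement is the evaluation set. *)
  by move/setP/(_ (a j)): hD; rewrite !inE imset_f // => ->.
apply/eqP; rewrite eqn_leq; apply/andP; split.
  by apply: error_dist_grs_le; apply: leq_trans le_k (leq_subr _ _).
by rewrite -[X in _ ^+ (X - 2)]hF; apply: error_dist_grs_inv_ge.
Qed.
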